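(* Let $s_1, s_2 \geq 1$ be integers. Let $b_n = b_n^{(s_1)}$ ($n \geq -2$) be defined by $b_n = b_{n-1} + b_{n-2}$ for $n \geq 0$, with $b_{-2} = 2^{s_1}$ and $b_{-1} = 2^{s_1-1}(s_1+2)$, and for $p \geq 1$ let $t(p,s_1,s_2) := 2^{s_2-1}\left(2b_{2p-3}^{(s_1)} + s_2\, b_{2p-4}^{(s_1)}\right)$. Then, as formal power series in $x$, $$\sum_{p=1}^\infty t(p,s_1,s_2)\, x^{p-1} = 2^{s_1+s_2-1}\cdot \frac{4 + 2(s_1+s_2)(1-x) + s_1 s_2 x}{1-3x+x^2}.$$ In particular, this generating function is symmetric in $s_1, s_2$, and hence $t(p,s_1,s_2) = t(p,s_2,s_1)$ for all $p \geq 1$.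
   Formalization: The prefactor 2^{s_1+s_2-1} is corrected to 2^{s_1+s_2-2}: as printed the right-hand side is twice too large (for s_1=s_2=1, t(1,1,1)=8 while the printed constant term is 16). *)

(* Defs.v *)
From HB Require Import structures.
From mathcomp Require Import all_boot all_order all_algebra.

Set Implicit Arguments.
Unset Strict Implicit.
Unset Printing Implicit Defensive.

Import Order.TTheory GRing.Theory Num.Theory.
Local Open Scope ring_scope.

(* Formal power series are coefficient sequences; equality of series is =1. *)
Definition fps (R : Type) := nat -> R.

Section FormalPowerSeries.
Variable R : comUnitRingType.
Implicit Types f g : fps R.

Definition fps_of_poly (p : {poly R}) : fps R := fun n => p`_n.

Definition fps_scale (c : R) f : fps R := fun n => c * f n.

Definition fps_mul f g : fps R := fun n => \sum_(i < n.+1) f i * g (n - i)%N.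

(* The first n.+1 coefficients of 1 / f, obtained by solving f * g = 1. *)
Fixpoint fps_inv_coefs f (n : nat) : seq R :=
  if n is m.+1 then
    let s := fps_inv_coefs f m in
    rcons s (- (f 0%N)^-1 * \sum_(i < m.+1) f i.+1 * s`_(m - i))
  else [:: (f 0%N)^-1].

(* Meaningful when the constant coefficient of f is a unit (see fps_mulrV). *)
Definition fps_inv f : fps R := fun n => (fps_inv_coefs f n)`_n.

Definition fps_div f g : fps R := fps_mul f (fps_inv g).

Lemma size_fps_inv_coefs f n : size (fps_inv_coefs f n) = n.+1.
Proof. by elim: n => //= n IHn; rewrite size_rcons IHn. Qed.

Lemma nth_fps_inv_coefs f m n :
  (m <= n)%N -> (fps_inv_coefs f n)`_m = fps_inv f m.
Proof.
elim: n => [|n IHn]; first by rewrite leqn0 => /eqP ->.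
rewrite leq_eqVlt => /orP[/eqP -> //|]; rewrite ltnS => le_mn.
by rewrite /= nth_rcons size_fps_inv_coefs ltnS le_mn IHn.
Qed.

Lemma fps_invS f n :
  fps_inv f n.+1 =
    - (f 0%N)^-1 * \sum_(i < n.+1) f i.+1 * fps_inv f (n - i)%N.
Proof.
rewrite {1}/fps_inv /= nth_rcons size_fps_inv_coefs ltnn eqxx.
by congr (_ * _); apply: eq_bigr => i _; rewrite nth_fps_inv_coefs ?leq_subr.
Qed.

Lemma fps_mulrV f : f 0%N \is a GRing.unit ->
  fps_mul f (fps_inv f) =1 fps_of_poly 1.
Proof.
move=> Uf [|n]; rewrite /fps_mul /fps_of_poly coef1.
  by rewrite big_ord_recl big_ord0 addr0 divrr.
rewrite big_ord_recl subn0 fps_invS mulrA mulrN divrr // mulN1r.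
by apply/eqP; rewrite addrC subr_eq0; apply/eqP; apply: eq_bigr.
Qed.

End FormalPowerSeries.

(* bshift s m is the term of index m - 2 of the sequence b^(s). *)
Fixpoint bshift (s m : nat) : int :=
  match m with
  | 0 => 2 ^+ s
  | 1 => 2 ^+ (s - 1) * (s%:Z + 2)
  | (m'.+1 as m1).+1 => bshift s m1 + bshift s m'
  end.

(* b s n is b_n^(s) for n >= -2; the value 0 for n < -2 is junk. *)
Definition b (s : nat) (n : int) : int :=
  if n + 2 is Posz m then bshift s m else 0.

Lemma b_m2 s : b s (-2) = 2 ^+ s.
Proof. by []. Qed.

Lemma b_m1 s : b s (-1) = 2 ^+ (s - 1) * (s%:Z + 2).
Proof. by []. Qed.

Lemma b_rec s (n : int) : 0 <= n -> b s n = b s (n - 1) + b s (n - 2).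
Proof.
case: n => // n _; rewrite /b subrK.
have -> : n%:Z - 1 + 2 = n.+1 by rewrite -addrA -[n.+1]addn1 PoszD.
by have -> : n%:Z + 2 = n.+2 by rewrite -[n.+2]addn2 PoszD.
Qed.

Definition t (p s1 s2 : nat) : int :=
  2 ^+ (s2 - 1) * (2 * b s1 (2 * p%:Z - 3) + s2%:Z * b s1 (2 * p%:Z - 4)).

(* The coefficient of x^n is t(n + 1, s1, s2). *)
Definition t_gf (s1 s2 : nat) : fps int := fun n => t n.+1 s1 s2.

(* Main.v *)
Require Import Defs.
From HB Require Import structures.
From mathcomp Require Import all_boot all_order all_algebra.
From mathcomp Require Import ring.

Set Implicit Arguments.
Unset Strict Implicit.
Unset Printing Implicit Defensive.

Import Order.TTheory GRing.Theory Num.Theory.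
Local Open Scope ring_scope.

(** Taking every second term of a Fibonacci-type sequence gives a sequence with
    [u (n + 2) = 3 u (n + 1) - u n], so both sides of the generating function
    identity have coefficients obeying this recurrence, and they agree at
    [n = 0] and [n = 1].  The right-hand side is visibly symmetric. *)

Section RationalSeries.
Variable R : comUnitRingType.
Implicit Types (p q : {poly R}) (f : fps R).

(** Coefficients of [p] from index 2 on vanish, so only the first two terms of the convolution
    survive. *)
Lemma fps_mul_poly_size2 p f n : (size p <= 2)%N ->
  fps_mul (fps_of_poly p) f n.+1 = p`_0 * f n.+1 + p`_1 * f n.
Proof.
move=> sz_p; rewrite /fps_mul /fps_of_poly !big_ord_recl big1 ?addr0 /=.
  by rewrite /bump /= subn0 subn1.
by move=> i _; rewrite nth_default ?mul0r // (leq_trans sz_p).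
Qed.

Lemma fps_inv_poly_size3 q n : (size q <= 3)%N ->
  fps_inv (fps_of_poly q) n.+2 =
    - (q`_0)^-1 * (q`_1 * fps_inv (fps_of_poly q) n.+1
                 + q`_2 * fps_inv (fps_of_poly q) n).
Proof.
move=> sz_q; rewrite fps_invS !big_ord_recl big1 ?addr0 /=.
  by rewrite /bump /= subn0 subn1.
by move=> i _; rewrite /fps_of_poly nth_default ?mul0r // (leq_trans sz_q).
Qed.

Lemma fps_div_poly0 p q :
  fps_div (fps_of_poly p) (fps_of_poly q) 0 = p`_0 * (q`_0)^-1.
Proof. by rewrite /fps_div /fps_mul big_ord_recl big_ord0 addr0. Qed.

Lemma fps_div_poly1 p q : (size p <= 2)%N ->
  fps_div (fps_of_poly p) (fps_of_poly q) 1 =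
    (p`_1 - p`_0 * (q`_0)^-1 * q`_1) * (q`_0)^-1.
Proof.
move=> sz_p; rewrite /fps_div fps_mul_poly_size2 // fps_invS.
by rewrite big_ord_recl big_ord0 /fps_inv /fps_of_poly /=; ring.
Qed.

(** Each positive-index coefficient of the quotient is a fixed combination of two consecutive
    coefficients of the inverse of [q], so it inherits their recurrence. *)
Lemma fps_div_poly_rec p q n : (size p <= 2)%N -> (size q <= 3)%N ->
  let h := fps_div (fps_of_poly p) (fps_of_poly q) in
  h n.+2 = - (q`_0)^-1 * (q`_1 * h n.+1 + q`_2 * h n).
Proof.
move=> sz_p sz_q h; rewrite /h /fps_div.
rewrite !fps_mul_poly_size2 // fps_inv_poly_size3 //.
(* For [n = 0], [h 0] has no [p]_1[term and the coefficient of index 1 of the inverse has no]q[_2]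
   term, so both are expanded by hand. *)
case: n => [|n]; last first.
  by rewrite fps_mul_poly_size2 // fps_inv_poly_size3 //; ring.
rewrite /fps_mul big_ord_recl big_ord0 fps_invS big_ord_recl big_ord0.
rewrite /fps_inv /fps_of_poly /=; ring.
Qed.

End RationalSeries.

(** With [u = bshift s]: u(n+4) = 2 u(n+2) + u(n+1), and u(n+1) = u(n+2) - u(n). *)
Lemma bshift_rec2 s n : bshift s n.+4 = 3 * bshift s n.+2 - bshift s n.
Proof. by rewrite /=; ring. Qed.

(** With p = n + 1, the indices 2p - 3 and 2p - 4 shifted by 2 become 2n + 1 and 2n, so the junk
    value of [b] never occurs. *)
Lemma t_gfE s1 s2 n :
  t_gf s1 s2 n = 2 ^+ (s2 - 1) * (2 * bshift s1 n.*2.+1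
                                  + s2%:Z * bshift s1 n.*2).
Proof.
rewrite /t_gf /t /b -muln2.
have -> : 2 * n.+1%:Z - 3 + 2 = (n * 2).+1%:Z
  by rewrite !intS PoszM; ring.
by have -> : 2 * n.+1%:Z - 4 + 2 = (n * 2)%:Z
  by rewrite !intS PoszM; ring.
Qed.

Lemma t_gf_rec s1 s2 n :
  t_gf s1 s2 n.+2 = 3 * t_gf s1 s2 n.+1 - t_gf s1 s2 n.
Proof. by rewrite !t_gfE !doubleS !bshift_rec2; ring. Qed.

(** The constant term fixes the exponent [s1 + s2 - 2]: [t 1 s1 s2] is 2^(s1+s2-1) (s1+s2+2), and
    the numerator at 0 is 2 (s1+s2+2). *)
Lemma t_gf_rational s1 s2 : (1 <= s1)%N -> (1 <= s2)%N ->
  t_gf s1 s2 =1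
    fps_scale (2 ^+ (s1 + s2 - 2))
      (fps_div
         (fps_of_poly (4 + (2 * (s1%:Z + s2%:Z))%:P * (1 - 'X)
                         + (s1%:Z * s2%:Z)%:P * 'X))
         (fps_of_poly (1 - 3 * 'X + 'X^2))).
Proof.
(* Writing [s1 = a.+1] and [s2 = c.+1] makes the truncated exponents exact. *)
case: s1 s2 => [|a] [|c] // _ _.
set S := (2 * _)%R; set P := (_%:Z * _)%R.
set p := (X in fps_of_poly X); set q := (X in fps_div _ (fps_of_poly X)).
(* Collecting powers of ['X] in 4 + S(1 - X) + PX; the list form yields the size and the
   coefficients. *)
have pE : p = Poly [:: 4 + S; P - S].
  rewrite /p /= !cons_poly_def mul0r add0r polyCB polyCD.
  by rewrite -[4%:P]/(4%:R%:P) polyC_natr; ring.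
have qE : q = Poly [:: 1; - 3; 1].
  rewrite /q /= !cons_poly_def mul0r add0r polyCN.
  by rewrite -[3%:P]/(3%:R%:P) polyC_natr; ring.
have sz_p : (size p <= 2)%N by rewrite pE size_Poly.
have sz_q : (size q <= 3)%N by rewrite qE size_Poly.
have [p0 p1] : p`_0 = 4 + S /\ p`_1 = P - S by rewrite pE !coef_Poly.
have [q0 q1 q2] : [/\ q`_0 = 1, q`_1 = - 3 & q`_2 = 1].
  by rewrite qE !coef_Poly.
have -> : (a.+1 + c.+1 - 2 = a + c)%N by rewrite addSn addnS subn2.
elim/ltn_ind=> -[|[|n]] IH; rewrite /fps_scale.
- rewrite fps_div_poly0 p0 q0 t_gfE /= invr1 !subn1 /= exprD exprS /S.
  by ring.
- rewrite fps_div_poly1 // p0 p1 q0 q1 t_gfE /= invr1 !subn1 /= exprD exprS.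
  by rewrite /S /P; ring.
rewrite t_gf_rec fps_div_poly_rec // !IH // /fps_scale q0 q1 q2 invr1.
by ring.
Qed.

Lemma t_gf_sym s1 s2 : (1 <= s1)%N -> (1 <= s2)%N ->
  t_gf s1 s2 =1 t_gf s2 s1.
Proof.
move=> hs1 hs2 n; rewrite !t_gf_rational // (addnC s2).
by rewrite (addrC s2%:Z) (mulrC s2%:Z).
Qed.

Theorem theorem1p2 (s1 s2 : nat) (hs1 : (1 <= s1)%N) (hs2 : (1 <= s2)%N) :
  [/\ t_gf s1 s2 =1
        fps_scale (2 ^+ (s1 + s2 - 2))
          (fps_div
             (fps_of_poly (4 + (2 * (s1%:Z + s2%:Z))%:P * (1 - 'X)
                             + (s1%:Z * s2%:Z)%:P * 'X))
             (fps_of_poly (1 - 3 * 'X + 'X^2))),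
      t_gf s1 s2 =1 t_gf s2 s1
    & forall p : nat, (1 <= p)%N -> t p s1 s2 = t p s2 s1].
Proof.
split; [exact: t_gf_rational | exact: t_gf_sym |].
(* [t p.+1 s1 s2] is [t_gf s1 s2 p] by definition. *)
by case=> // p _; apply: t_gf_sym.
Qed.
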